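(* Let $r>0$, let $Q\in\mathbb{R}^{n\times n}$ be symmetric positive definite, and let $\gamma\in(0,2)$. Let $\{\mathbf{w}^k\}_{k\ge0}$, $\mathbf{w}^k=(\mathbf{x}^k;\lambda^k)$, together with $\widetilde{\mathbf{w}}^k=(\widetilde{\mathbf{x}}^k;\widetilde\lambda^k)$, be generated by P-rALM from an arbitrary starting point $\mathbf{w}^0\in\mathbb{R}^n\times\mathbb{R}^m$. For integers $T>0$ and $\kappa\ge0$ define $$\mathbf{w}_T=\frac1{T+1}\sum_{k=\kappa}^{T+\kappa}\widetilde{\mathbf{w}}^k,\qquad \mathbf{x}_T=\frac1{T+1}\sum_{k=\kappa}^{T+\kappa}\widetilde{\mathbf{x}}^k .$$ Then $$\theta(\mathbf{x}_T)-\theta(\mathbf{x})+\langle\mathbf{w}_T-\mathbf{w},\mathcal{J}(\mathbf{w})\rangle\le\frac{1}{2\gamma(T+1)}\|\mathbf{w}^\kappa-\mathbf{w}\|_H^2\qquad\text{for all }\mathbf{w}=(\mathbf{x};\lambda)\in\mathcal{M}.$$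
   Context: Problem: $\min\{\theta(\mathbf{x})\mid A\mathbf{x}=b \text{ (or } A\mathbf{x}\ge b),\ \mathbf{x}\in\mathcal{X}\}$, where $\theta:\mathbb{R}^n\to\mathbb{R}$ is a closed proper convex function, $\mathcal{X}\subseteq\mathbb{R}^n$ is a closed convex set, $A\in\mathbb{R}^{m\times n}$, $b\in\mathbb{R}^m$. Its solution set is assumed nonempty. Put $\Lambda=\mathbb{R}^m$ in the case of the equality constraint $A\mathbf{x}=b$, and $\Lambda=\mathbb{R}^m_+$ (nonnegative vectors) in the case of the inequality constraint $A\mathbf{x}\ge b$. Let $\mathcal{P}_\Lambda$ be the Euclidean projection onto $\Lambda$, and $\mathcal{M}=\mathcal{X}\times\Lambda$. For $\mathbf{w}=(\mathbf{x};\lambda)$ let $\mathcal{J}(\mathbf{w})=\begin{pmatrix}-A^{T}\lambda\\ A\mathbf{x}-b\end{pmatrix}$. P-rALM with parameters $\gamma\in(0,2)$, $r>0$, $Q\succ 0$: for $k=0,1,2,\dots$, $$\widetilde{\mathbf{x}}^k=\arg\min_{\mathbf{x}\in\mathcal{X}}\ \theta(\mathbf{x})-\langle\lambda^k,A\mathbf{x}-b\rangle+\tfrac r2\|A(\mathbf{x}-\mathbf{x}^k)\|^2+\tfrac12\|\mathbf{x}-\mathbf{x}^k\|_Q^2,$$ $$\widetilde{\lambda}^k=\mathcal{P}_\Lambda\big(\lambda^k-r[A(2\widetilde{\mathbf{x}}^k-\mathbf{x}^k)-b]\big),$$ $$\mathbf{x}^{k+1}=\mathbf{x}^k+\gamma(\widetilde{\mathbf{x}}^k-\mathbf{x}^k),\qquad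 \lambda^{k+1}=\lambda^k+\gamma(\widetilde{\lambda}^k-\lambda^k).$$ Here $\|\cdot\|$ is the Euclidean norm, $\|\mathbf{w}\|_H=\sqrt{\langle\mathbf{w},H\mathbf{w}\rangle}$ for symmetric positive definite $H$, and $$H=\begin{bmatrix} rA^{T}A+Q & A^{T}\\ A & \frac1r\mathbf{I}\end{bmatrix},$$ which is symmetric positive definite. *)

(* Defs.v *)
From HB Require Import structures.
From mathcomp Require Import all_boot all_order all_algebra.
From mathcomp Require Import all_classical all_reals all_analysis.

Set Implicit Arguments.
Unset Strict Implicit.
Unset Printing Implicit Defensive.

Import Order.TTheory GRing.Theory Num.Theory.
Import numFieldNormedType.Exports.

Local Open Scope classical_set_scope.
Local Open Scope ring_scope.

Section Euclidean.
Context {R : realType}.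

Definition dot {n} (u v : 'cV[R]_n) : R := (u^T *m v) 0 0.

(* The norm `|u| that MathComp-Analysis puts on matrices is the sup norm, hence
   this separate Euclidean norm. *)
Definition enorm {n} (u : 'cV[R]_n) : R := Num.sqrt (dot u u).

Definition wnorm {n} (M : 'M[R]_n) (u : 'cV[R]_n) : R :=
  Num.sqrt (dot u (M *m u)).

Definition sym_posdef {n} (M : 'M[R]_n) : Prop :=
  M^T = M /\ forall u : 'cV[R]_n, u != 0 -> 0 < dot u (M *m u).

Definition is_argmin {T : Type} (S : set T) (f : T -> R) (x : T) : Prop :=
  S x /\ forall y, S y -> f x <= f y.

Definition is_projection {n} (S : set 'cV[R]_n) (v p : 'cV[R]_n) : Prop :=
  is_argmin S (fun z => enorm (z - v)) p.

End Euclidean.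

Section ConvexFunctions.
Context {R : realType}.

Definition epigraph {T : Type} (f : T -> \bar R) : set (T * R) :=
  [set p | (f p.1 <= p.2%:E)%E].

Definition proper_function {T : Type} (f : T -> \bar R) : Prop :=
  (forall x, -oo < f x)%E /\ (exists x, f x < +oo)%E.

Definition closed_proper_convex {n} (theta : 'cV[R]_n -> R) : Prop :=
  [/\ closed (epigraph (EFin \o theta)), proper_function (EFin \o theta) &
      convex_function [set: 'cV[R]_n] theta].

End ConvexFunctions.

Inductive constraint_kind := Equality | Inequality.

Section Problem.
Context {R : realType} {m n : nat}.
Implicit Types (c : constraint_kind) (A : 'M[R]_(m, n)) (b : 'cV[R]_m)
  (X : set 'cV[R]_n) (theta : 'cV[R]_n -> R).

Definition feasible c A b X : set 'cV[R]_n :=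
  [set x | X x /\ match c with
                  | Equality => A *m x = b
                  | Inequality => forall i, b i 0 <= (A *m x) i 0
                  end].

Definition solution_set c A b X theta : set 'cV[R]_n :=
  [set x | is_argmin (feasible c A b X) theta x].

Definition Lambda c : set 'cV[R]_m :=
  match c with
  | Equality => [set: 'cV[R]_m]
  | Inequality => [set l | forall i, 0 <= l i 0]
  end.

(* Primal-dual pairs w = (x; lambda) are stacked column vectors: x is
   [usubmx w] and lambda is [dsubmx w]. *)
Definition calM c X : set 'cV[R]_(n + m) :=
  [set w | X (usubmx w) /\ Lambda c (dsubmx w)].

Definition calJ A b (w : 'cV[R]_(n + m)) : 'cV[R]_(n + m) :=
  col_mx (- (A^T *m dsubmx w)) (A *m usubmx w - b).

Definition Hmx A (r : R) (Q : 'M[R]_n) : 'M[R]_(n + m) :=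
  block_mx (r *: (A^T *m A) + Q) A^T A (r^-1)%:M.

Definition PrALM c A b X theta (r : R) (Q : 'M[R]_n) (gamma : R)
    (x xt : nat -> 'cV[R]_n) (l lt : nat -> 'cV[R]_m) : Prop :=
  forall k : nat,
  [/\ is_argmin X
        (fun y => theta y - dot (l k) (A *m y - b)
                  + r / 2 * enorm (A *m (y - x k)) ^+ 2
                  + 1 / 2 * wnorm Q (y - x k) ^+ 2) (xt k),
      is_projection (Lambda c)
        (l k - r *: (A *m (2 *: xt k - x k) - b)) (lt k),
      x k.+1 = x k + gamma *: (xt k - x k) &
      l k.+1 = l k + gamma *: (lt k - l k)].

End Problem.

Definition ergodic_mean {R : realType} {n} (u : nat -> 'cV[R]_n)
    (T kappa : nat) : 'cV[R]_n :=
  (T.+1%:R)^-1 *: \sum_(kappa <= k < (T + kappa).+1) u k.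

(* Main.v *)
(** The optimality condition of the x-subproblem and that of the projection,
    divided by [r], add up to the variational inequality
      theta(u) - theta(xt^k) + <w - wt^k, J(wt^k) + H (wt^k - w^k)> >= 0
    for w = (u; mu) in M. As J is affine with a skew linear part, J(wt^k) may be
    replaced by J(w). Since w^{k+1} = w^k + gamma (wt^k - w^k) and gamma < 2, the
    H-term is at most (|w^k - w|_H^2 - |w^{k+1} - w|_H^2) / (2 gamma), which
    telescopes; Jensen's inequality passes to the ergodic mean. *)

Require Import Defs.
From HB Require Import structures.
From mathcomp Require Import all_boot all_order all_algebra.
From mathcomp Require Import all_classical all_reals all_analysis.
From mathcomp Require Import ring lra.

Set Implicit Arguments.
Unset Strict Implicit.
Unset Printing Implicit Defensive.

Import Order.TTheory GRing.Theory Num.Theory.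
Import numFieldNormedType.Exports.

Local Open Scope classical_set_scope.
Local Open Scope ring_scope.

(** * Bilinear algebra of the Euclidean inner product *)

Section Dot.
Context {R : realType} {n : nat}.
Implicit Types u v w : 'cV[R]_n.

Lemma dotC u v : dot u v = dot v u.
Proof. by rewrite /dot -[u^T *m v]trmxK trmx_mul trmxK mxE. Qed.

Lemma dotDl u v w : dot (u + v) w = dot u w + dot v w.
Proof. by rewrite /dot linearD mulmxDl mxE. Qed.

Lemma dotDr u v w : dot u (v + w) = dot u v + dot u w.
Proof. by rewrite /dot mulmxDr mxE. Qed.

Lemma dotZl t u v : dot (t *: u) v = t * dot u v.
Proof. by rewrite /dot linearZ -scalemxAl mxE. Qed.

Lemma dotZr t u v : dot u (t *: v) = t * dot u v.
Proof. by rewrite /dot -scalemxAr mxE. Qed.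

Lemma dotNl u v : dot (- u) v = - dot u v.
Proof. by rewrite -scaleN1r dotZl mulN1r. Qed.

Lemma dotNr u v : dot u (- v) = - dot u v.
Proof. by rewrite -scaleN1r dotZr mulN1r. Qed.

Lemma dot_suml (I : Type) (s : seq I) (P : pred I) (F : I -> 'cV[R]_n) v :
  dot (\sum_(i <- s | P i) F i) v = \sum_(i <- s | P i) dot (F i) v.
Proof.
rewrite (big_morph (fun u => dot u v) (id1 := 0) (op1 := +%R)) //.
  by move=> u w; rewrite dotDl.
by rewrite -(scale0r 0) dotZl mul0r.
Qed.

Lemma dot_ge0 u : 0 <= dot u u.
Proof.
by rewrite /dot mxE sumr_ge0// => i _; rewrite mxE -expr2 sqr_ge0.
Qed.

Lemma enorm_sqr u : enorm u ^+ 2 = dot u u.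
Proof. by rewrite sqr_sqrtr ?dot_ge0. Qed.

End Dot.

Definition dotE := (@dotDl, @dotDr, @dotNl, @dotNr, @dotZl, @dotZr).

Lemma dot_mulmx {R : realType} {m n : nat} (A : 'M[R]_(m, n)) u v :
  dot (A^T *m u) v = dot u (A *m v).
Proof. by rewrite /dot trmx_mul trmxK mulmxA. Qed.

Lemma dot_col_mx {R : realType} {m n : nat} (u u' : 'cV[R]_n) (v v' : 'cV[R]_m) :
  dot (col_mx u v) (col_mx u' v') = dot u u' + dot v v'.
Proof. by rewrite /dot tr_col_mx mul_row_col mxE. Qed.

(** * Quadratic forms of symmetric matrices *)

Section QuadraticForms.
Context {R : realType} {n : nat}.
Implicit Types (M Q : 'M[R]_n) (u v : 'cV[R]_n).

Lemma sym_posdef_ge0 Q u : sym_posdef Q -> 0 <= dot u (Q *m u).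
Proof.
move=> [_ Qpos]; have [->|/Qpos/ltW//] := eqVneq u 0.
by rewrite mulmx0 dot_ge0.
Qed.

Lemma wnorm_sqr M u : 0 <= dot u (M *m u) -> wnorm M u ^+ 2 = dot u (M *m u).
Proof. exact: sqr_sqrtr. Qed.

Lemma dot_symC M u v : M^T = M -> dot u (M *m v) = dot v (M *m u).
Proof. by move=> symM; rewrite -dot_mulmx symM dotC. Qed.

(** Grouped by powers of [t], the form in which [argmin_variational] reads off its coefficients [s]
    and [q]. *)
Lemma dot_quadD M u v t : M^T = M ->
  dot (u + t *: v) (M *m (u + t *: v)) =
  dot u (M *m u) + t * (2 * dot v (M *m u)) + t ^+ 2 * dot v (M *m v).
Proof.
move=> symM; rewrite mulmxDr -scalemxAr !dotE (dot_symC u v symM); ring.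
Qed.

Lemma dot_sqrD u v t :
  dot (u + t *: v) (u + t *: v) =
  dot u u + t * (2 * dot v u) + t ^+ 2 * dot v v.
Proof. rewrite !dotE (dotC u v); ring. Qed.

End QuadraticForms.

(** * Convexity: Jensen's inequality and first-order optimality conditions *)

Section Convexity.
Context {R : realType} {n : nat}.
Implicit Types (S : set 'cV[R]_n) (f g : 'cV[R]_n -> R).

Lemma convex_set_conv S t x y : convex_set S -> 0 <= t -> t <= 1 ->
  S x -> S y -> S (t *: x + (1 - t) *: y).
Proof.
move=> cS t0 t1 Sx Sy.
by have /set_mem := cS x y (Itv01 t0 t1) (mem_set Sx) (mem_set Sy).
Qed.

Lemma convex_function_conv f t x y : convex_function [set: 'cV[R]_n] f ->
  0 <= t -> t <= 1 -> f (t *: x + (1 - t) *: y) <= t * f x + (1 - t) * f y.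
Proof.
move=> cf t0 t1.
exact: (cf (Itv01 t0 t1) x y (mem_set I) (mem_set I)).
Qed.

(** Induction on [T]: the mean of T+2 terms is the convex combination of the last term, with weight
    1/(T+2), and the mean of the first T+1. *)
Lemma convex_ergodic_mean f (u : nat -> 'cV[R]_n) (T kappa : nat) :
  convex_function [set: 'cV[R]_n] f ->
  f (ergodic_mean u T kappa) <=
    T.+1%:R^-1 * \sum_(kappa <= k < (T + kappa).+1) f (u k).
Proof.
move=> cf; elim: T => [|T IH].
  by rewrite /ergodic_mean add0n !big_nat1 invr1 scale1r mul1r.
have ltk : (kappa <= (T + kappa).+1)%N by rewrite leqW ?leq_addl.
rewrite addSn big_nat_recr //=.
set s : R := T.+2%:R^-1.
have TE : T.+2%:R = T.+1%:R + 1 :> R by rewrite -[T.+2]addn1 natrD.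
have T0 : 0 < T.+1%:R :> R by rewrite ltr0n.
have sE : s * (T.+1%:R + 1) = 1 by rewrite -TE mulVf ?pnatr_eq0.
have s0 : 0 <= s by rewrite invr_ge0 ler0n.
have s1 : s <= 1 by rewrite invf_le1 ?ltr0n // ler1n.
have Ts : 1 - s = s * T.+1%:R by lra.
have -> : ergodic_mean u T.+1 kappa =
    s *: u (T + kappa).+1 + (1 - s) *: ergodic_mean u T kappa.
  rewrite /ergodic_mean addSn big_nat_recr //= scalerDr addrC; congr (_ + _).
  by rewrite scalerA Ts mulfK ?gt_eqF.
apply: (le_trans (convex_function_conv _ _ cf s0 s1)).
rewrite mulrDr addrC lerD2r.
apply: (le_trans (ler_wpM2l _ IH)); first by lra.
by rewrite mulrA Ts mulfK ?gt_eqF.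
Qed.

(* Minimality gives [0 <= t (f y - f z + s) + t^2 q] on the segment from [z] to
   [y], which fails for small [t] if [f y - f z + s] is negative. *)
Lemma argmin_variational S f g z y s q :
  convex_set S -> convex_function [set: 'cV[R]_n] f ->
  is_argmin S (fun v => f v + g v) z -> S y ->
  (forall t, g (z + t *: (y - z)) = g z + t * s + t ^+ 2 * q) ->
  0 <= f y - f z + s.
Proof.
move=> cS cf [Sz minz] Sy gE; rewrite leNgt; apply/negP => D0.
set D := f y - f z + s in D0.
have pos : 0 < `|q| - D by have := normr_ge0 q; lra.
(* This [t] gives t (|q| - D) = -D/2, so D + t q <= D/2 + t D < 0, while t <= 1/2 stays on the
   segment. *)
pose t : R := - D / (2 * (`|q| - D)).
have tE : t * (2 * (`|q| - D)) = - D by rewrite divfK // mulf_neq0 ?gt_eqF.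
have t0 : 0 < t by rewrite divr_gt0 ?mulr_gt0 ?oppr_gt0.
have t1 : t <= 1.
  by rewrite ler_pdivrMr ?mulr_gt0 // mul1r; have := normr_ge0 q; lra.
have segE : z + t *: (y - z) = t *: y + (1 - t) *: z.
  by rewrite scalerBr scalerBl scale1r addrCA addrA.
have := minz _ (convex_set_conv cS (ltW t0) t1 Sy Sz).
have := convex_function_conv y z cf (ltW t0) t1.
rewrite -segE gE => fle gle.
have : 0 <= t * (D + t * q) by rewrite /D; lra.
rewrite pmulr_rge0 // => ge0.
have : t * q <= t * `|q| by rewrite ler_pM2l // ler_norm.
have : 0 < t * (- D) by rewrite mulr_gt0 // oppr_gt0.
lra.
Qed.

(** A nearest point also minimizes the squared distance, so [argmin_variational] applies with zero
    convex part; the squared distance has slope 2 <y - p, p - v> along the segment. *)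
Lemma projection_variational S v p y :
  convex_set S -> is_projection S v p -> S y -> 0 <= dot (y - p) (p - v).
Proof.
move=> cS [Sp minp] Sy.
suff : 0 <= 0 - 0 + 2 * dot (y - p) (p - v) by lra.
apply: (@argmin_variational S (cst 0) (fun z => enorm (z - v) ^+ 2) p y _
    (dot (y - p) (y - p)) cS) => //.
- by move=> t a b _ _; rewrite convRE /cst !mulr0 addr0.
- split=> // z /minp; rewrite /= !add0r.
  by rewrite ler_sqr ?nnegrE ?sqrtr_ge0.
- by move=> t; rewrite !enorm_sqr addrAC dot_sqrD.
Qed.

Lemma Lambda_convex c : convex_set (@Lambda R n c).
Proof.
move=> x y t /set_mem Lx /set_mem Ly; apply: mem_set.
case: c Lx Ly => //= Lx Ly i.
rewrite !mxE addr_ge0 // mulr_ge0 //.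
by rewrite subr_ge0 le1.
Qed.

End Convexity.

(** * One iteration of P-rALM *)

Section Step.
Context {R : realType} {m n : nat}.
Variables (c : constraint_kind) (A : 'M[R]_(m, n)) (b : 'cV[R]_m).
Variables (r : R) (Q : 'M[R]_n).
Hypotheses (r_gt0 : 0 < r) (Q_spd : sym_posdef Q).

Lemma dot_Hmx (x1 x2 : 'cV[R]_n) (l1 l2 : 'cV[R]_m) :
  dot (col_mx x1 l1) (Hmx A r Q *m col_mx x2 l2) =
  r * dot (A *m x1) (A *m x2) + dot x1 (Q *m x2) +
  dot (A *m x1) l2 + dot l1 (A *m x2) + r^-1 * dot l1 l2.
Proof.
rewrite mul_block_col dot_col_mx mulmxDl -scalemxAl -mulmxA mul_scalar_mx.
rewrite !dotE (dotC x1 (A^T *m (A *m x2))) (dotC x1 (A^T *m l2)) !dot_mulmx.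
rewrite (dotC (A *m x2)) (dotC l2); ring.
Qed.

Lemma Hmx_sym : (Hmx A r Q)^T = Hmx A r Q.
Proof.
rewrite /Hmx tr_block_mx linearD linearZ /= trmx_mul !trmxK tr_scalar_mx.
by rewrite (proj1 Q_spd).
Qed.

(** Completing the square in the multiplier leaves the [Q]-form plus r |A x + l / r|^2. This allows
    the square root in [wnorm] to be undone. *)
Lemma Hmx_ge0 (w : 'cV[R]_(n + m)) : 0 <= dot w (Hmx A r Q *m w).
Proof.
rewrite -(vsubmxK w); set x := usubmx w; set l := dsubmx w.
have -> : dot (col_mx x l) (Hmx A r Q *m col_mx x l) =
    dot x (Q *m x) + r * dot (A *m x + r^-1 *: l) (A *m x + r^-1 *: l).
  rewrite dot_Hmx !dotE (dotC l (A *m x)); field.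
  by rewrite gt_eqF.
by rewrite addr_ge0 ?sym_posdef_ge0 // mulr_ge0 ?dot_ge0 ?ltW.
Qed.

Context (X : set 'cV[R]_n) (theta : 'cV[R]_n -> R).
Hypotheses (X_convex : convex_set X)
  (theta_convex : convex_function [set: 'cV[R]_n] theta).

Lemma primal_variational (l : 'cV[R]_m) (x xt u : 'cV[R]_n) :
  is_argmin X
    (fun y => theta y - dot l (A *m y - b)
              + r / 2 * enorm (A *m (y - x)) ^+ 2
              + 1 / 2 * wnorm Q (y - x) ^+ 2) xt ->
  X u ->
  0 <= theta u - theta xt - dot l (A *m (u - xt))
       + r * dot (A *m (u - xt)) (A *m (xt - x))
       + dot (u - xt) (Q *m (xt - x)).
Proof.
move=> [Xxt minxt] Xu.
(* The three terms after theta u - theta xt become the slope [s] of the smooth part of the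
   objective. *)
rewrite -!(addrA (theta u - theta xt)).
apply: (@argmin_variational _ _ X theta
  (fun y => - dot l (A *m y - b) + r / 2 * enorm (A *m (y - x)) ^+ 2
            + 1 / 2 * wnorm Q (y - x) ^+ 2) xt u _
  (r / 2 * dot (A *m (u - xt)) (A *m (u - xt))
   + 1 / 2 * dot (u - xt) (Q *m (u - xt)))) => //.
  by split=> // y /minxt; rewrite !addrA.
move=> t; rewrite !enorm_sqr !wnorm_sqr ?sym_posdef_ge0 //.
rewrite (addrAC xt (t *: (u - xt)) (- x)) dot_quadD; last exact: (proj1 Q_spd).
rewrite !(mulmxDr A (xt - x)) -!scalemxAr dot_sqrD.
have -> : A *m (xt + t *: (u - xt)) = A *m xt + t *: (A *m (u - xt)).
  by rewrite mulmxDr -scalemxAr.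
rewrite !dotE; by field.
Qed.

(** The off-diagonal blocks of H have two sources: replacing [l] by [lt] in the primal condition
    leaves A^T (lt - l), and writing 2 xt - x = xt + (xt - x) in the dual one leaves A (xt - x). *)
Lemma PrALM_step_variational (x xt u : 'cV[R]_n) (l lt mu : 'cV[R]_m) :
  is_argmin X
    (fun y => theta y - dot l (A *m y - b)
              + r / 2 * enorm (A *m (y - x)) ^+ 2
              + 1 / 2 * wnorm Q (y - x) ^+ 2) xt ->
  is_projection (Lambda c) (l - r *: (A *m (2 *: xt - x) - b)) lt ->
  X u -> Lambda c mu ->
  theta xt - theta u
    + dot (col_mx xt lt - col_mx u mu) (calJ A b (col_mx u mu))
  <= dot (col_mx u mu - col_mx xt lt)
       (Hmx A r Q *m (col_mx xt lt - col_mx x l)).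
Proof.
move=> primal dual Xu Lmu.
have := primal_variational primal Xu.
have := projection_variational (@Lambda_convex _ _ c) dual Lmu.
rewrite /calJ col_mxKu col_mxKd !opp_col_mx !add_col_mx !dot_Hmx.
rewrite dot_col_mx.
(* All vectors are expressed through the step (dx; dl), the error (ex; el), the residual p and mu,
   so that the claim becomes a polynomial identity in inner products. *)
pose dx := xt - x; pose ex := x - u; pose dl := lt - l; pose el := l - mu.
pose p := A *m u - b.
have -> : mu - lt = - (el + dl) by rewrite /el /dl [in RHS]addrC subrKA opprB.
have -> : u - xt = - (ex + dx) by rewrite /ex /dx [in RHS]addrC subrKA opprB.
have -> : xt - u = ex + dx by rewrite /ex /dx [in RHS]addrC subrKA.
have -> : lt - mu = el + dl by rewrite /el /dl [in RHS]addrC subrKA.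
have -> : lt - (l - r *: (A *m (2 *: xt - x) - b)) =
    dl + r *: (p + A *m ex + 2 *: (A *m dx)).
  rewrite opprB addrCA addrC; congr (_ + _ *: _).
  rewrite /p /ex /dx !mulmxBr -scalemxAr !scalerBr !scaler_nat !mulr2n.
  by apply/matrixP => i j; rewrite !mxE; ring.
rewrite -/dl.
have -> : l = mu + el by rewrite /el addrC subrK.
rewrite -/dx -/p => dual_ge0 primal_ge0.
clearbody dx ex dl el p.
have r0 : r != 0 by rewrite gt_eqF.
have rV_ge0 : 0 <= r^-1 by rewrite invr_ge0 ltW.
(* This sum equals right side minus left side of the goal; what remains is to order the symmetric
   products alike. *)
have := addr_ge0 primal_ge0 (mulr_ge0 rV_ge0 dual_ge0).
rewrite -[X in _ -> is_true X]subr_ge0; congr (is_true (0 <= _)).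
rewrite !mulmxN !mulmxDr !dotE.
rewrite (dotC ex (A^T *m mu)) (dotC dx (A^T *m mu)) !dot_mulmx.
rewrite (dotC mu (A *m ex)) (dotC mu (A *m dx)) (dotC el (A *m ex)).
rewrite (dotC el (A *m dx)) (dotC dl (A *m ex)) (dotC dl (A *m dx)).
rewrite (dotC (A *m ex) (A *m dx)) (dotC el dl).
by field.
Qed.

(** With step d and error e, the right side is -2 gamma <d, H e> - gamma^2 <d, H d>. It exceeds the
    variational bound by gamma (2 - gamma) <d, H d> >= 0. *)
Lemma PrALM_step_decrease gamma (x xt u : 'cV[R]_n) (l lt mu : 'cV[R]_m) :
  0 < gamma -> gamma < 2 ->
  is_argmin X
    (fun y => theta y - dot l (A *m y - b)
              + r / 2 * enorm (A *m (y - x)) ^+ 2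
              + 1 / 2 * wnorm Q (y - x) ^+ 2) xt ->
  is_projection (Lambda c) (l - r *: (A *m (2 *: xt - x) - b)) lt ->
  X u -> Lambda c mu ->
  2 * gamma * (theta xt - theta u
    + dot (col_mx xt lt - col_mx u mu) (calJ A b (col_mx u mu)))
  <= wnorm (Hmx A r Q) (col_mx x l - col_mx u mu) ^+ 2
     - wnorm (Hmx A r Q) (col_mx (x + gamma *: (xt - x))
         (l + gamma *: (lt - l)) - col_mx u mu) ^+ 2.
Proof.
move=> g0 g2 primal dual Xu Lmu.
have := PrALM_step_variational primal dual Xu Lmu.
set gap := theta xt - theta u + _.
rewrite !wnorm_sqr ?Hmx_ge0 // -add_col_mx -scale_col_mx.
have -> : col_mx (xt - x) (lt - l) = col_mx xt lt - col_mx x l.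
  by rewrite opp_col_mx add_col_mx.
rewrite addrAC.
set e := col_mx x l - col_mx u mu; set d := col_mx xt lt - col_mx x l.
have -> : col_mx u mu - col_mx xt lt = - (d + e).
  by rewrite /d /e subrKA opprB.
clearbody d e.
rewrite (dot_quadD _ _ _ Hmx_sym) !dotE (dot_symC e d Hmx_sym) => gap_le.
have d_ge0 := Hmx_ge0 d.
have : 0 <= gamma * (2 - gamma) * dot d (Hmx A r Q *m d).
  by rewrite !mulr_ge0 // ?subr_ge0 ltW.
have : 2 * gamma * gap <=
    2 * gamma * - (dot d (Hmx A r Q *m d) + dot d (Hmx A r Q *m e)).
  by rewrite ler_pM2l // mulr_gt0.
lra.
Qed.

End Step.

(** * Summation over the iterations and averaging *)

Theorem theorem2p3 (R : realType) (m n : nat) (c : constraint_kind)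
  (A : 'M[R]_(m, n)) (b : 'cV[R]_m)
  (X : set 'cV[R]_n) (theta : 'cV[R]_n -> R)
  (theta_cpc : closed_proper_convex theta)
  (X_closed : closed X) (X_convex : convex_set X)
  (sol_nonempty : solution_set c A b X theta !=set0)
  (r : R) (r_gt0 : 0 < r)
  (Q : 'M[R]_n) (Q_spd : sym_posdef Q)
  (gamma : R) (gamma_gt0 : 0 < gamma) (gamma_lt2 : gamma < 2)
  (x xt : nat -> 'cV[R]_n) (lam lamt : nat -> 'cV[R]_m)
  (gen : PrALM c A b X theta r Q gamma x xt lam lamt)
  (T kappa : nat) (T_gt0 : (0 < T)%N) :
  let w_ k := col_mx (x k) (lam k) in
  let wt_ k := col_mx (xt k) (lamt k) in
  let wT := ergodic_mean wt_ T kappa in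
  let xT := ergodic_mean xt T kappa in
  forall w : 'cV[R]_(n + m), calM c X w ->
    theta xT - theta (usubmx w) + dot (wT - w) (calJ A b w)
      <= 1 / (2 * gamma * T.+1%:R) * wnorm (Hmx A r Q) (w_ kappa - w) ^+ 2.
Proof.
move=> w_ wt_ wT xT w [].
have [_ _ theta_convex] := theta_cpc.
rewrite -[w]vsubmxK; set u := usubmx w; set mu := dsubmx w.
rewrite col_mxKu col_mxKd => Xu Lmu.
pose J := calJ A b (col_mx u mu).
pose gap k := theta (xt k) - theta u + dot (wt_ k - col_mx u mu) J.
pose V k := wnorm (Hmx A r Q) (w_ k - col_mx u mu) ^+ 2.
have step k : 2 * gamma * gap k <= V k - V k.+1.
  have [primal dual xS lamS] := gen k.
  rewrite /V /gap /w_ /wt_ xS lamS.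
  exact: (PrALM_step_decrease r_gt0 Q_spd X_convex theta_convex gamma_gt0
    gamma_lt2 primal dual Xu Lmu).
have sum_gap : 2 * gamma * \sum_(kappa <= k < (T + kappa).+1) gap k <= V kappa.
  rewrite mulr_sumr; apply: le_trans.
    by apply: ler_sum => k _; exact: step.
  (* The sign is flipped to match [telescope_sumr]; the final [V] is then dropped as a square. *)
  under eq_bigr do rewrite -opprB.
  rewrite sumrN telescope_sumr ?leqW ?leq_addl //.
  by rewrite opprB gerBl sqr_ge0.
have N0 : 0 < T.+1%:R :> R by rewrite ltr0n.
have mean_cst (a : R) :
    T.+1%:R^-1 * \sum_(kappa <= k < (T + kappa).+1) a = a.
  by rewrite sumr_const_nat -addSn addnK -[a *+ _]mulr_natl mulKf ?gt_eqF.
(* The duality term is affine in the iterate, so it averages with equality; only [theta] needs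
   Jensen. *)
have mean_dot : dot (wT - col_mx u mu) J =
    T.+1%:R^-1 * \sum_(kappa <= k < (T + kappa).+1) dot (wt_ k - col_mx u mu) J.
  under eq_bigr do rewrite dotDl.
  by rewrite big_split /= mulrDr mean_cst -dot_suml dotDl dotZl.
have mean_gap : theta xT - theta u + dot (wT - col_mx u mu) J
    <= T.+1%:R^-1 * \sum_(kappa <= k < (T + kappa).+1) gap k.
  rewrite mean_dot /gap !big_split /= !mulrDr mean_cst !lerD2r.
  exact: convex_ergodic_mean.
apply: (le_trans mean_gap).
rewrite -/(V kappa) mul1r invfM mulrAC [leRHS]mulrC.
by rewrite ler_wpM2l ?invr_ge0 ?ler0n // ler_pdivlMl ?mulr_gt0.
Qed.
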